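(* Let $\{X_i\}_{i=1}^{\infty}$ be a sequence of negatively associated random variables on the upper probability space $(\Omega,\mathcal{F},\mathcal{P},\mathbb{V})$ such that $\sup_{i\ge 1}\mathbb{E}[|X_i|^{\alpha+1}]<\infty$ for some constant $\alpha>0$. Let $\{a_i\}_{i=1}^{\infty}$ be a sequence of bounded positive numbers (i.e. a bounded sequence of positive numbers) and let $\{A_n\}_{n=1}^{\infty}$ be a sequence of positive numbers such that $$\lim_{n\to\infty}\frac{A_n}{n^{\frac{1}{\beta+1}}}=\infty,$$ where $\beta$ is a constant with $\beta\in(0,\min(1,\alpha))$. Then for any continuous function $\varphi$ on $\mathbb{R}$, $$v\left(\limsup_{n\to\infty}\varphi\left(\frac{\sum_{i=1}^{n}a_i(X_i-\mathbb{E}[X_i])}{A_n}\right)\le \sup_{x\le 0}\varphi(x)\right)=1,$$ $$v\left(\liminf_{n\to\infty}\varphi\left(\frac{\sum_{i=1}^{n}a_i(X_i-\mathcal{E}[X_i])}{A_n}\right)\ge \inf_{x\ge 0}\varphi(x)\right)=1.$$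
   Context: Let $(\Omega,\mathcal{F})$ be a measurable space and $\mathcal{P}$ a nonempty set of probability measures on it. For $A\in\mathcal{F}$ set $\mathbb{V}(A)=\sup_{P\in\mathcal{P}}P(A)$ (upper probability) and $v(A)=\inf_{P\in\mathcal{P}}P(A)$ (lower probability). For a random variable $X$ with $E_P[|X|]<\infty$ for all $P\in\mathcal{P}$ (or $X\ge 0$, with values in $[0,\infty]$ allowed for the expectation), set $\mathbb{E}[X]=\sup_{P\in\mathcal{P}}E_P[X]$ and $\mathcal{E}[X]=\inf_{P\in\mathcal{P}}E_P[X]$, where $E_P$ is the classical expectation under $P$. $(\Omega,\mathcal{F},\mathcal{P},\mathbb{V})$ is called the upper probability space. Let $C_b^+(\mathbb{R})$ be the set of nonnegative bounded continuous functions on $\mathbb{R}$. Functions have ''the same monotonicity'' if they are all nondecreasing or all nonincreasing. A sequence $\{X_i\}_{i=1}^{\infty}$ of random variables is negatively associated if for every $n\ge 1$ and every sequence $\{f_i\}_{i=1}^{\infty}\subset C_b^+(\mathbb{R})$ with the same monotonicity, $\mathbb{E}\left[\prod_{i=1}^{n+1}f_i(X_i)\right]\le \mathbb{E}\left[\prod_{i=1}^{n}f_i(X_i)\right]\,\mathbb{E}[f_{n+1}(X_{n+1})]$. Suprema, infima, limsup and liminf are taken in $[-\infty,\infty]$. *)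

(* Defs.v *)
From HB Require Import structures.
From mathcomp Require Import all_boot all_order all_algebra.
From mathcomp Require Import all_classical all_reals all_analysis.

Set Implicit Arguments.
Unset Strict Implicit.
Unset Printing Implicit Defensive.

Import Order.TTheory GRing.Theory Num.Theory.
Import numFieldNormedType.Exports.

Local Open Scope classical_set_scope.
Local Open Scope ring_scope.

Section UpperProbabilitySpace.
Context {d : measure_display} {Omega : measurableType d} {R : realType}.
Variable calP : set (probability Omega R).

Definition upper_prob (A : set Omega) : \bar R :=
  ereal_sup [set P A | P in calP].

Definition lower_prob (A : set Omega) : \bar R :=
  ereal_inf [set P A | P in calP].

(* ['E_P[X]] is a total operation; the two definitions below carry the intended
   meaning when X >= 0 or when X is integrable under every P in calP. *)
Definition upper_exp (X : Omega -> R) : \bar R :=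
  ereal_sup [set 'E_P[X]%E | P in calP].

Definition lower_exp (X : Omega -> R) : \bar R :=
  ereal_inf [set 'E_P[X]%E | P in calP].

End UpperProbabilitySpace.

Definition Cb_plus {R : realType} : set (R -> R) :=
  [set f : R -> R | [/\ continuous f, bounded_fun f & forall x, 0 <= f x]].

(* Sequences are indexed by i >= 1; the value at index 0 is never used. *)
Definition same_monotonicity {R : realType} (f : nat -> R -> R) : Prop :=
  (forall i, (1 <= i)%N -> {homo f i : x y / x <= y}) \/
  (forall i, (1 <= i)%N -> {homo f i : x y / x <= y >-> y <= x}).

Definition negatively_associated {d : measure_display}
    {Omega : measurableType d} {R : realType}
    (calP : set (probability Omega R)) (X : nat -> Omega -> R) : Prop :=
  forall (n : nat) (f : nat -> R -> R), (1 <= n)%N ->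
    (forall i, (1 <= i)%N -> Cb_plus (f i)) -> same_monotonicity f ->
    (upper_exp calP (fun w => (\prod_(1 <= i < n.+2) f i (X i w))%R) <=
     upper_exp calP (fun w => (\prod_(1 <= i < n.+1) f i (X i w))%R) *
     upper_exp calP (fun w => f n.+1 (X n.+1 w)))%E.

(* Main.v *)
Require Import Defs.
From HB Require Import structures.
From mathcomp Require Import all_boot all_order all_algebra.
From mathcomp Require Import all_classical all_reals all_analysis.
From mathcomp Require Import measurable_realfun.
From mathcomp Require Import ring lra.

Import Order.TTheory GRing.Theory Num.Theory.
Import numFieldNormedType.Exports.
Local Open Scope classical_set_scope.
Local Open Scope ring_scope.

(** Since [phi] is continuous, both assertions only say on which side of [0] the
    normalised sums accumulate: if every [e > 0] eventually bounds [S_n / A_n]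
    from above, then [phi (S_n / A_n)] cannot accumulate above the supremum of
    [phi] on the nonpositive half-line ([limn_esup_comp_le]).  The lower
    assertion is the upper one for [- X_i] and [x |-> - phi (- x)], as negative
    association is stable under [X |-> - X] ([negatively_associatedN]).  Because
    the lower probability is an infimum, it remains to show, separately for each
    [P] in the family, that [S_n <= c + n^theta] eventually, [P]-almost surely,
    where [theta = 1 / (beta + 1)] and [c] may depend on the sample point: this
    bound is negligible before [A_n].

    That bound is a one-sided Chernoff argument.  With [q = min 2 (alpha + 1)] one
    has [theta * q > 1], so some [eta] satisfies [1 / q < eta < theta].  Replace
    [X_i] by [min X_i i^eta].

    - Truncation from above only lowers means, so the truncated variable minus the
      upper mean [mu_i] has nonpositive mean under every [P].  Hence
      [exp x <= 1 + x + |x|^q exp B] for [x <= B] yields, with [t = n^-eta], an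
      exponential moment at most [1 + O(n^-(eta q))], uniformly in [P] and
      [i <= n] ([upper_exp_truncated_term]); the exponent is bounded above since
      [t * i^eta <= 1].
    - [x |-> exp (t a_i (min x i^eta - mu_i))] is bounded, continuous and
      nondecreasing, so negative association multiplies these bounds
      ([upper_exp_prod_le]); as [eta q > 1] the product of [n] of them stays
      bounded.
    - Markov's inequality then bounds the probability that the truncated sum
      exceeds [n^theta] by a constant times [exp (- n^(theta - eta))], which is
      summable ([truncated_sum_tail]).
    - [P (X_i >= i^eta) <= K / i^(eta q)] is summable too, so almost surely only
      finitely many terms are changed by truncation, which costs a constant.

    The Borel-Cantelli lemma concludes ([ae_weighted_sum_le]). *)

(** * Real inequalities *)

(** A second-order Taylor bound weakened to the power [q <= 2]; only an upper
    bound on [x] is required, which is why truncation from above suffices.  For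
    [|x| <= 1] it follows from [(1 - x) * expR x <= 1], multiplied by
    [1 + x >= 0]; for [|x| > 1] the term [|x| `^ q >= |x|] dominates. *)
Lemma expR_le_moment {R : realType} (q B x : R) : 1 <= q -> q <= 2 -> 0 <= B ->
  x <= B -> expR x <= 1 + x + `|x| `^ q * expR B.
Proof.
move=> q1 q2 B0 xB.
have eB1 : 1 <= expR B by rewrite -expR0 ler_expR.
have exB : expR x <= expR B by rewrite ler_expR.
have ge1 : 1 <= `|x| -> `|x| <= `|x| `^ q by move=> h; apply: le1r_powR.
have [x1|x1] := lerP `|x| 1; last first.
  have := ge1 (ltW x1).
  have [x0|x0] := ltrP x 0.
    rewrite ltr0_norm// => h.
    have : expR x <= 1 by rewrite -expR0 ler_expR ltW.
    nra.
  rewrite ger0_norm// in x1 *; nra.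
have h1 : (1 - x) * expR x <= 1.
  have := expR_ge1Dx (- x); rewrite expRN => h.
  have e0 := expR_gt0 x.
  by rewrite -ler_pdivlMr// mul1r.
have hx : -1 <= x <= 1 by rewrite -ler_norml.
have xq : x ^+ 2 <= `|x| `^ q.
  have [->|xn0] := eqVneq x 0; first by rewrite expr0n/= powR_ge0.
  rewrite -real_normK ?num_real// -powR_mulrn//.
  by apply: ger_powR => //; rewrite normr_gt0 xn0.
have e0 := expR_gt0 x.
have : expR x <= 1 + x + x ^+ 2 * expR x by nra.
have : x ^+ 2 * expR x <= `|x| `^ q * expR B.
  by apply: ler_pM; rewrite ?sqr_ge0 ?expR_ge0.
lra.
Qed.

Lemma powRD_le {R : realType} (q u v : R) : 0 <= q -> 0 <= u -> 0 <= v ->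
  (u + v) `^ q <= 2 `^ q * (u `^ q + v `^ q).
Proof.
move=> q0 u0 v0.
wlog uv : u v u0 v0 / u <= v.
  move=> H; have [uv|/ltW vu] := lerP u v; first exact: H.
  by rewrite addrC [_ `^ q + _]addrC; exact: H.
apply: (@le_trans _ _ ((2 * v) `^ q)).
  by apply: ge0_ler_powR; rewrite ?nnegrE//; lra.
rewrite powRM// ler_wpM2l ?powR_ge0//.
by rewrite lerDr powR_ge0.
Qed.

(** Telescoping: with [r = s - 1], each term is at most [1 / r] times the
    decrement of [n |-> n `^ (- r)], because
    [(1 + 1 / n) `^ r >= 1 + r / (n + 1)]. *)
Lemma sum_powR_bounded {R : realType} (s : R) : 1 < s ->
  exists C : R, forall n, \sum_(1 <= i < n.+1) (i%:R `^ s)^-1 <= C.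
Proof.
move=> s1; pose r := s - 1; have r0 : 0 < r by rewrite subr_gt0.
have step n : (1 <= n)%N ->
    (n.+1%:R `^ s)^-1 <= r^-1 * ((n%:R `^ r)^-1 - (n.+1%:R `^ r)^-1) :> R.
  move=> n1.
  have n0 : 0 < n%:R :> R by rewrite ltr0n.
  have m0 : 0 < n.+1%:R :> R by rewrite ltr0n.
  have pn : 0 < n%:R `^ r by rewrite powR_gt0.
  have pm : 0 < n.+1%:R `^ r by rewrite powR_gt0.
  have ratio : 1 + r / n.+1%:R <= n.+1%:R `^ r / n%:R `^ r.
    rewrite /powR !gt_eqF// -expRN -expRD -mulrBr.
    apply: le_trans (expR_ge1Dx _).
    rewrite lerD2l ler_wpM2l ?(ltW r0)//.
    rewrite -ln_div ?posrE//.
    rewrite -[leRHS]opprK -lnV ?posrE ?divr_gt0// invf_div lerNr.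
    have -> : n%:R / n.+1%:R = 1 + - n.+1%:R^-1 :> R.
      by rewrite -natr1 in m0 *; field; rewrite gt_eqF.
    apply: le_ln1Dx; rewrite ltrN2 invf_lt1// ltr1n ltnS.
    exact: n1.
  have -> : n.+1%:R `^ s = n.+1%:R * n.+1%:R `^ r.
    by rewrite mulr_powRB1// (lt_trans _ s1).
  rewrite [leRHS]mulrC ler_pdivlMr//.
  have -> : (n%:R `^ r)^-1 = (n.+1%:R `^ r / n%:R `^ r) / n.+1%:R `^ r.
    by field; rewrite !gt_eqF.
  apply: (@le_trans _ _ ((1 + r / n.+1%:R) / n.+1%:R `^ r - (n.+1%:R `^ r)^-1)).
    by rewrite le_eqVlt; apply/orP; left; apply/eqP; field; rewrite !gt_eqF.
  by rewrite lerD2r ler_pM2r// invr_gt0.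
exists (1 + r^-1) => n.
suff : \sum_(1 <= i < n.+2) (i%:R `^ s)^-1 <=
    1 + r^-1 * (1 - (n.+1%:R `^ r)^-1) :> R.
  rewrite big_nat_recr//=.
  have : 0 <= (n.+1%:R `^ s)^-1 :> R by rewrite invr_ge0 powR_ge0.
  have : r^-1 * (1 - (n.+1%:R `^ r)^-1) <= r^-1 :> R.
    by rewrite ger_pMr ?invr_gt0// gerBl invr_ge0 powR_ge0.
  lra.
elim: n => [|n ih].
  by rewrite big_nat1 !powR1 invr1 subrr mulr0 addr0.
rewrite big_nat_recr//=.
have := step n.+1 isT; lra.
Qed.

(** Any stretched exponential is summable: compare [expR] with the Taylor term of
    an order [k + 1] for which [e * (k + 1) >= 2]. *)
Lemma expRN_powR_le {R : realType} (e : R) : 0 < e ->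
  exists C : R, 0 <= C /\
    forall n, (1 <= n)%N -> expR (- n%:R `^ e) <= C / n%:R `^ 2.
Proof.
move=> e0.
pose k := Num.truncn (2 / e).
have ke : 2 <= e * k.+1%:R.
  have : 2 / e < k.+1%:R by apply: Num.Theory.truncnS_gt.
  by rewrite ltr_pdivrMr// mulrC => /ltW.
exists (k.+1`!%:R); split => // n n1.
have n1R : 1 <= n%:R :> R by rewrite ler1n.
have := @expR_ge1Dxn R (n%:R `^ e) k (powR_ge0 _ _).
rewrite -powR_mulrn ?powR_ge0// -powRrM => H.
have F0 : 0 < (k.+1`!)%:R :> R by rewrite ltr0n fact_gt0.
have n2 : 0 < n%:R `^ 2 :> R by rewrite powR_gt0// (lt_le_trans ltr01).
have : n%:R `^ 2 / (k.+1`!)%:R <= expR (n%:R `^ e).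
  apply: le_trans H; rewrite ler_wpDl// ler_pM2r ?invr_gt0//.
  by apply: ler_powR.
rewrite expRN -[_ / n%:R `^ 2]invf_div => h.
by rewrite lef_pV2// posrE ?expR_gt0// divr_gt0.
Qed.

(** Values with [y n <= 0] are controlled by the supremum itself, and those in
    [0, delta] by the continuity of [phi] at [0]. *)
Lemma limn_esup_comp_le {R : realType} (phi : R -> R) (y : nat -> R) :
  continuous phi ->
  (forall e, 0 < e -> \forall n \near \oo, y n <= e) ->
  (limn_esup (fun n => (phi (y n))%:E) <=
   ereal_sup [set (phi x)%:E | x in [set x : R | (x <= 0)%R]])%E.
Proof.
move=> phic yle; set s := ereal_sup _.
have ubs x : x <= 0 -> ((phi x)%:E <= s)%E.
  by move=> x0; apply: ereal_sup_ubound; exists x.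
have := ubs 0 (lexx _).
case: s ubs => [s||] ubs// _; last by rewrite leey.
apply/lee_addgt0Pr => e e0.
have /cvgrPdist_le/(_ _ e0) := phic 0.
move=> /nbhs_ballP[del /= del0 ballP].
rewrite limn_esup_lim; apply: lime_le; first exact: is_cvg_esups.
have d2 : 0 < del / 2 by rewrite divr_gt0.
have [N _ HN] := yle _ d2.
exists N => // n /= Nn.
apply: ub_ereal_sup => _ [k /= nk <-].
have yk : y k <= del / 2 by apply: HN => /=; exact: leq_trans Nn nk.
have [y0|y0] := lerP (y k) 0.
  by apply: (le_trans (ubs _ y0)); rewrite -EFinD lee_fin lerDl ltW.
have : ball 0 del (y k).
  rewrite /ball/= sub0r normrN gtr0_norm//; lra.
move=> /ballP.
have := ubs 0 (lexx _); rewrite -EFinD !lee_fin.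
rewrite distrC ler_norml => a /andP[_ b]; lra.
Qed.

(** * Almost sure events and moments under one probability *)

(** Borel-Cantelli; the shifted sequence [G] discards the event of index [0],
    which need not even be measurable. *)
Lemma ae_eventually_notin {d : measure_display} {Omega : measurableType d}
    {R : realType} (P : probability Omega R) (F : nat -> set Omega) (C s : R) :
  1 < s -> (forall n, (1 <= n)%N -> measurable (F n)) ->
  (forall n, (1 <= n)%N -> (P (F n) <= (C / n%:R `^ s)%:E)%E) ->
  {ae P, forall w, \forall n \near \oo, ~ F n w}.
Proof.
move=> s1 mF PF.
pose G n := F n.+1.
have mG n : measurable (G n) by exact: mF.
have C0 : 0 <= C.
  have := le_trans (measure_ge0 P (F 1%N)) (PF 1%N isT).
  by rewrite lee_fin powR1 divr1.
exists (lim_sup_set G); split.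
- by apply: bigcap_measurable => // n _; exact: bigcup_measurable.
- apply: lim_sup_set_cvg0 => //.
  have [K HK] := sum_powR_bounded _ s1.
  apply: (@le_lt_trans _ _ (C * K)%:E); last exact: ltry.
  apply: lime_le; first exact: is_cvg_nneseries.
  apply: nearW => n /=.
  apply: (@le_trans _ _ (\sum_(0 <= i < n) (C / i.+1%:R `^ s)%:E)%E).
    by apply: lee_sum => i _; exact: PF.
  rewrite sumEFin lee_fin -mulr_sumr ler_wpM2l//.
  by have := HK n; rewrite big_add1.
- move=> w /= nw n _; apply: contrapT => H; apply: nw.
  exists n.+1 => // -[//|k] /= nk Fk; apply: H.
  by exists k.
Qed.

Section moments.
Context {d : measure_display} {Omega : measurableType d} {R : realType}.
Variables (P : probability Omega R) (X : {mfun Omega >-> R}) (q K : R).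
Hypothesis EK : ('E_P[fun w => (`|X w| `^ q)%R] <= K%:E)%E.

Lemma measurable_norm_powR : measurable_fun setT (fun w => `|X w| `^ q).
Proof.
apply: (measurableT_comp (measurable_powR q)).
exact: measurableT_comp.
Qed.

Lemma Lfun1_norm_powR : (fun w => `|X w| `^ q) \in Lfun P 1.
Proof.
apply/Lfun1_integrable/integrableP; split.
  exact/measurable_EFinP/measurable_norm_powR.
apply: le_lt_trans (ltry K).
move: EK; rewrite unlock; apply: le_trans.
rewrite le_eqVlt; apply/orP; left; apply/eqP; apply: eq_integral => w _.
by rewrite /= ger0_norm ?powR_ge0.
Qed.

Hypothesis q1 : 1 <= q.

Lemma norm_le1DpowR (x : R) : `|x| <= 1 + `|x| `^ q.
Proof.
have [x1|/ltW x1] := lerP `|x| 1; first by rewrite ler_wpDr ?powR_ge0.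
by rewrite ler_wpDl// le1r_powR.
Qed.

Lemma Lfun1_of_powR : (X : Omega -> R) \in Lfun P 1.
Proof.
apply/Lfun1_integrable.
have iY : P.-integrable setT (EFin \o (fun w => 1 + `|X w| `^ q)).
  apply/Lfun1_integrable.
  have -> : (fun w => 1 + `|X w| `^ q) = cst 1 \+ (fun w => `|X w| `^ q) by [].
  by apply: rpredD; [exact: Lfun_cst|exact: Lfun1_norm_powR].
apply: le_integrable iY => //; first exact/measurable_EFinP.
move=> w _ /=; rewrite lee_fin [leRHS]ger0_norm ?addr_ge0 ?powR_ge0//.
exact: norm_le1DpowR.
Qed.

Lemma expectation_norm_le : ('E_P[fun w => `|X w|%R] <= (1 + K)%:E)%E.
Proof.
apply: (@le_trans _ _ 'E_P[(cst 1 \+ (fun w => `|X w| `^ q))%R]%E).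
  apply: expectation_le => //.
  - exact: measurableT_comp.
  - by apply: measurable_funD => //; exact: measurable_norm_powR.
  - by move=> w /=; rewrite addr_ge0 ?powR_ge0.
  - by apply: aeW => w /=; exact: norm_le1DpowR.
rewrite expectationD ?Lfun_cst ?Lfun1_norm_powR//.
by rewrite expectation_cst EFinD leeD2l.
Qed.

Lemma abse_expectation_le : (`|'E_P[X]| <= (1 + K)%:E)%E.
Proof.
apply: le_trans expectation_norm_le; rewrite unlock.
by apply: le_abse_integral => //; exact/measurable_EFinP.
Qed.

Lemma expectationN : 'E_P[fun w => (- X w)%R]%E = (- 'E_P[X])%E.
Proof.
have -> : (fun w => - X w) = (-1 : R) \o* X.
  by apply/funext => w /=; rewrite mulrN1.
by rewrite expectationZl ?Lfun1_of_powR// EFinN mulN1e.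
Qed.

(** The linear term of [expR_le_moment] has nonpositive expectation, since
    truncating [X] from above can only lower a mean that is already at most
    [mu]; only the moment of order [q] is left. *)
Lemma expectation_expR_min_le (mu m c l B : R) : q <= 2 -> 0 <= c -> 0 <= l ->
  0 <= B -> l * (c + m) <= B -> `|mu| <= m -> ('E_P[X] <= mu%:E)%E ->
  ('E_P[fun w => expR (l * (Num.min (X w) c - mu))%R] <=
    (1 + l `^ q * (2 `^ q * (K + m `^ q) * expR B))%:E)%E.
Proof.
move=> q2 c0 l0 B0 lB mum EX.
have m0 : 0 <= m by apply: le_trans mum.
pose D := l `^ q * (2 `^ q * expR B).
have D0 : 0 <= D by rewrite !mulr_ge0 ?powR_ge0 ?expR_ge0.
pose Y := fun w => `|X w| `^ q.
pose k := 1 - l * mu + D * m `^ q.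
(* [h w = 1 + l (X w - mu) + D (|X w|^q + m^q)] is an integrable majorant. *)
pose h : Omega -> R := (cst k \+ (l \o* X)) \+ (D \o* Y).
have LX := Lfun1_of_powR; have LY : Y \in Lfun P 1 := Lfun1_norm_powR.
have LlX : l \o* X \in Lfun P 1 by exact: Lfun_scale.
have LDY : D \o* Y \in Lfun P 1 by exact: Lfun_scale.
have key w : expR (l * (Num.min (X w) c - mu)) <= h w.
  have : l * (Num.min (X w) c - mu) <= B.
    apply: le_trans lB; rewrite ler_wpM2l// lerD ?ge_min ?lexx ?orbT//.
    by move: mum; rewrite ler_norml => /andP[]; rewrite lerNl.
  move=> /(expR_le_moment _ _ _ q1 q2 B0) /le_trans; apply.
  have -> : h w = 1 + l * (X w - mu) +
      l `^ q * (2 `^ q * (`|X w| `^ q + m `^ q)) * expR B.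
    by rewrite /h/= /k /D /Y; ring.
  apply: lerD.
    by rewrite lerD2l ler_wpM2l// lerD2r ge_min lexx.
  rewrite ler_wpM2r ?expR_ge0// normrM powRM// (ger0_norm l0).
  rewrite ler_wpM2l ?powR_ge0//.
  apply: le_trans (powRD_le _ _ _ _ _ _) => //; last exact: le_trans q1.
  apply: ge0_ler_powR; rewrite ?nnegrE ?addr_ge0//; first exact: le_trans q1.
  apply: (le_trans (ler_normB _ _)); rewrite lerD//.
  rewrite /Num.min; case: ifPn => // ; rewrite -leNgt => cX.
  by rewrite (ger0_norm c0) (le_trans cX)// ler_norm.
apply: (@le_trans _ _ 'E_P[h]%E).
  apply: expectation_le => //.
  - apply: measurableT_comp => //; apply: measurable_funM => //.
    by apply: measurable_funB => //; exact: measurable_minr.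
  - rewrite /h; apply: measurable_funD.
      by apply: measurable_funD => //; exact: measurable_funM.
    by apply: measurable_funM => //; exact: measurable_norm_powR.
  - by move=> w; apply: le_trans (key w); exact: expR_ge0.
  - by apply: aeW => w; exact: key.
rewrite /h expectationD//; last by rewrite rpredD ?Lfun_cst.
rewrite expectationD ?Lfun_cst// !expectationZl// expectation_cst.
have := expectation_fin_num LX; have := expectation_fin_num LY.
move: EX EK; rewrite -/Y.
case: ('E_P[X])%E => // x; case: ('E_P[Y])%E => // y.
rewrite !lee_fin => xmu yK _ _.
have h1 : l * x <= l * mu by rewrite ler_wpM2l.
have h2 : D * y <= D * K by rewrite ler_wpM2l.
have -> : 1 + l `^ q * (2 `^ q * (K + m `^ q) * expR B) =
   1 + D * K + D * m `^ q by rewrite /D; ring.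
rewrite /k; lra.
Qed.

Lemma markov_powR (c : R) : 0 < c ->
  (P [set w | (c <= X w)%R] <= (K / c `^ q)%:E)%E.
Proof.
move=> c0.
have cq : 0 < c `^ q by rewrite powR_gt0.
have q0 : 0 <= q := le_trans ler01 q1.
have : ((c `^ q)%:E * P [set w | c%:E <= `|(X w)%:E|]%E <= K%:E)%E.
  apply: le_trans EK.
  have := @markov _ _ _ P X (fun x => x `^ q) c c0 (measurable_powR q).
  apply.
  - by move=> r _; exact: powR_ge0.
  - exact: ge0_ler_powR.
rewrite muleC -lee_pdivlMr// -EFinM; apply: le_trans.
apply: le_measure; rewrite ?inE.
- rewrite -[X in measurable X]setTI.
  exact: measurable_fun_le.
- rewrite -[X in measurable X]setTI; apply: emeasurable_fun_c_infty => //.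
  by apply: measurableT_comp => //; exact/measurable_EFinP.
- by move=> w /= cX; rewrite lee_fin (le_trans cX)// ler_norm.
Qed.

End moments.

(** * Upper expectations and negative association *)

Lemma expectation_le_upper_exp {d : measure_display} {Omega : measurableType d}
    {R : realType} (calP : set (probability Omega R)) (P : probability Omega R)
    (Y : Omega -> R) : calP P -> ('E_P[Y] <= upper_exp calP Y)%E.
Proof. by move=> calPP; apply: ereal_sup_ubound; exists P. Qed.

Lemma upper_exp_le {d : measure_display} {Omega : measurableType d}
    {R : realType} (calP : set (probability Omega R)) (Y : Omega -> R)
    (x : \bar R) :
  (forall P, calP P -> ('E_P[Y] <= x)%E) -> (upper_exp calP Y <= x)%E.
Proof. by move=> H; apply: ub_ereal_sup => _ [P calPP <-]; exact: H. Qed.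

Lemma upper_exp_ge0 {d : measure_display} {Omega : measurableType d}
    {R : realType} (calP : set (probability Omega R)) (Y : Omega -> R) :
  calP !=set0 -> (forall w, 0 <= Y w) -> (0 <= upper_exp calP Y)%E.
Proof.
move=> [P calPP] Y0; apply: le_trans (expectation_le_upper_exp _ _ Y calPP).
exact: expectation_ge0.
Qed.

(** Negative association splits off only the last factor, at the cost of keeping
    an upper expectation of the remaining product; induction on the number of
    factors turns this into a product of one-variable upper expectations. *)
Lemma upper_exp_prod_le {d : measure_display} {Omega : measurableType d}
    {R : realType} (calP : set (probability Omega R)) (X : nat -> Omega -> R)
    (f : nat -> R -> R) (u : R) (n : nat) :
  calP !=set0 -> negatively_associated calP X ->
  (forall i, (1 <= i)%N -> Cb_plus (f i)) -> same_monotonicity f ->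
  (1 <= n)%N ->
  (forall i, (1 <= i <= n)%N ->
    (upper_exp calP (fun w => f i (X i w)) <= u%:E)%E) ->
  (upper_exp calP (fun w => (\prod_(1 <= i < n.+1) f i (X i w))%R) <=
    (u ^+ n)%:E)%E.
Proof.
move=> calP0 XNA fCb fmono n1.
have f0 i x : (1 <= i)%N -> 0 <= f i x by move=> /fCb[].
elim: n n1 => // -[_ _ fu|n ih _ fu].
  under [X in upper_exp _ X]eq_fun do rewrite big_nat1.
  by rewrite expr1; exact: fu.
apply: (le_trans (XNA n.+1 f isT fCb fmono)).
rewrite exprSr EFinM; apply: lee_pmul.
- apply: upper_exp_ge0 => // w; rewrite big_nat_cond; apply: prodr_ge0 => i.
  by rewrite andbT => /andP[i1 _]; exact: f0.
- by apply: upper_exp_ge0 => // w; exact: f0.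
- by apply: ih => // i /andP[i1 im]; apply: fu; rewrite i1 leqW.
- by apply: fu; rewrite leqnn.
Qed.

(** The exponential is unbounded, but truncating its argument from above makes it
    an admissible test function for negative association. *)
Lemma Cb_plus_expR_min {R : realType} (k l c mu : R) : 0 <= k -> 0 <= l ->
  Cb_plus (fun x => expR (k * (l * (Num.min x c - mu)))).
Proof.
move=> k0 l0; split; last by move=> x; exact: expR_ge0.
- move=> x; apply: continuous_comp; last exact: continuous_expR.
  apply: cvgM; first exact: cvg_cst.
  apply: cvgM; first exact: cvg_cst.
  apply: cvgB; last exact: cvg_cst.
  by apply: continuous_min; [exact: cvg_id|exact: cvg_cst].
- exists (expR (k * (l * (c - mu)))); split; first exact: num_real.
  move=> B lB x _ /=; rewrite ger0_norm ?expR_ge0//.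
  apply: le_trans (ltW lB); rewrite ler_expR ler_wpM2l// ler_wpM2l//.
  by rewrite lerD2r ge_min lexx orbT.
Qed.

(** * One-sided almost sure bound for weighted sums *)

Section one_sided_law.
Context {d : measure_display} {Omega : measurableType d} {R : realType}.
Variables (calP : set (probability Omega R)) (X : nat -> {mfun Omega >-> R}).
Variables (q K m M eta theta : R) (a mu : nat -> R).
Hypothesis calP0 : calP !=set0.
Hypothesis XNA : negatively_associated calP (fun i => X i : Omega -> R).
Hypotheses (q1 : 1 <= q) (q2 : q <= 2).
Hypothesis EXq : forall P i, calP P -> (1 <= i)%N ->
  ('E_P[fun w => (`|X i w| `^ q)%R] <= K%:E)%E.
Hypothesis EXmu : forall P i, calP P -> (1 <= i)%N -> ('E_P[X i] <= (mu i)%:E)%E.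
Hypothesis mum : forall i, (1 <= i)%N -> `|mu i| <= m.
Hypothesis a0 : forall i, (1 <= i)%N -> 0 < a i.
Hypothesis aM : forall i, (1 <= i)%N -> a i <= M.
Hypotheses (etaq : 1 < eta * q) (etatheta : eta < theta).

Let eta0 : 0 < eta.
Proof. by rewrite ltNge; apply/negP => h; move: etaq q1; nra. Qed.

Definition truncated_term i w := a i * (Num.min (X i w) (i%:R `^ eta) - mu i).

Definition truncated_sum n w := \sum_(1 <= i < n.+1) truncated_term i w.

Lemma measurable_truncated_sum n : measurable_fun setT (truncated_sum n).
Proof.
apply: measurable_sum => i; apply: measurable_funM => //.
by apply: measurable_funB => //; exact: measurable_minr.
Qed.

Let M0 : 0 < M. Proof. exact: lt_le_trans (a0 1 isT) (aM 1 isT). Qed.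
Let m0 : 0 <= m. Proof. exact: le_trans (normr_ge0 _) (mum 1 isT). Qed.

Let D := 2 `^ q * (K + m `^ q) * expR (M * (1 + m)).

Let D0 : 0 <= D.
Proof.
have [P calPP] := calP0.
have K0 : 0 <= K.
  have := EXq P 1 calPP isT; rewrite -lee_fin; apply: le_trans.
  by apply: expectation_ge0 => w; exact: powR_ge0.
by rewrite !mulr_ge0 ?addr_ge0 ?powR_ge0 ?expR_ge0.
Qed.

(** The parameter [n `^ (- eta)] is tuned to the largest truncation level
    [n `^ eta], so that the exponent never exceeds [M * (1 + m)]. *)
Lemma upper_exp_truncated_term n i : (1 <= i <= n)%N ->
  (upper_exp calP (fun w => expR ((n%:R `^ eta)^-1 * truncated_term i w)) <=
   (1 + M `^ q * D / (n%:R `^ (eta * q)))%:E)%E.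
Proof.
move=> /andP[i1 iN]; set t := (n%:R `^ eta)^-1.
have n0 : 0 < n%:R :> R by rewrite ltr0n (leq_trans i1).
have t0 : 0 < t by rewrite invr_gt0 powR_gt0.
have t1 : t <= 1.
  rewrite invf_le1 ?powR_gt0// -[leLHS](powRr0 n%:R) ler_powR ?(ltW eta0)//.
  by rewrite ler1n (leq_trans i1).
have tc : t * i%:R `^ eta <= 1.
  rewrite mulrC ler_pdivrMr ?powR_gt0// mul1r.
  by apply: ge0_ler_powR; rewrite ?(ltW eta0) ?nnegrE ?ler0n ?ler_nat.
have ta : 0 <= t * a i by rewrite mulr_ge0 ?(ltW t0) ?(ltW (a0 i i1)).
have taM : t * a i <= t * M by rewrite ler_wpM2l ?(ltW t0)// aM.
apply: upper_exp_le => P calPP.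
under [X in 'E_P[X]%E]eq_fun do rewrite /truncated_term mulrA.
have B0 : 0 <= M * (1 + m) by rewrite mulr_ge0 ?(ltW M0)// addr_ge0.
have lB : t * a i * (i%:R `^ eta + m) <= M * (1 + m).
  apply: (@le_trans _ _ (t * M * (i%:R `^ eta + m))).
    by rewrite ler_wpM2r// addr_ge0 ?powR_ge0.
  rewrite (mulrC t) -mulrA ler_wpM2l ?(ltW M0)// mulrDr lerD//.
  exact: ler_piMl.
apply: le_trans (expectation_expR_min_le P (X i) q K (EXq P i calPP i1) q1
  (mu i) m _ _ (M * (1 + m)) q2 (powR_ge0 _ _) ta B0 lB (mum i i1)
  (EXmu P i calPP i1)) _.
rewrite lee_fin lerD2l -/D [leRHS]mulrAC ler_wpM2r//.
have -> : (n%:R `^ (eta * q))^-1 = t `^ q.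
  by rewrite /t -powRN -powRN -powRrM mulNr.
rewrite -powRM ?(ltW t0) ?(ltW M0)//.
apply: ge0_ler_powR; rewrite ?nnegrE ?(le_trans _ q1)// ?[M * t]mulrC//.
by rewrite mulr_ge0 ?(ltW t0) ?(ltW M0).
Qed.

Let C := expR (M `^ q * D).

(** Chernoff's bound: the [n] factors [1 + O(n `^ (- (eta * q)))] have a bounded
    product because [1 < eta * q]. *)
Lemma truncated_sum_tail P n : calP P -> (1 <= n)%N ->
  (P [set w | (n%:R `^ theta <= truncated_sum n w)%R] <=
    (C * expR (- n%:R `^ (theta - eta)))%:E)%E.
Proof.
move=> calPP n1.
have n0 : 0 < n%:R :> R by rewrite ltr0n.
pose t := (n%:R `^ eta)^-1.
have t0 : 0 < t by rewrite invr_gt0 powR_gt0.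
pose f i x := expR (t * (a i * (Num.min x (i%:R `^ eta) - mu i))).
pose S : {mfun Omega >-> R} := mfun_Sub (mem_set (measurable_truncated_sum n)).
have := @chernoff _ _ _ P S t (n%:R `^ theta) t0.
have -> : t * n%:R `^ theta = n%:R `^ (theta - eta).
  by rewrite powRB ?gt_eqF ?implybT// mulrC.
move=> /le_trans; apply.
rewrite [leRHS]EFinM; apply: lee_wpmul2r; first by rewrite lee_fin expR_ge0.
pose u := 1 + M `^ q * D / (n%:R `^ (eta * q)).
apply: (@le_trans _ _ (u ^+ n)%:E).
  rewrite /mmt_gen_fun.
  have -> : expR \o t \o* S = (fun w => \prod_(1 <= i < n.+1) f i (X i w)).
    apply/funext => w /=; rewrite -expR_sum; congr expR.
    by rewrite mulrC /truncated_sum mulr_sumr.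
  apply: le_trans (expectation_le_upper_exp _ _ _ calPP) _.
  apply: upper_exp_prod_le => //.
  - by move=> i i1; apply: Cb_plus_expR_min; rewrite ltW// a0.
  - left => i i1 x y xy; rewrite /f ler_expR ler_wpM2l ?(ltW t0)//.
    rewrite ler_wpM2l ?(ltW (a0 i i1))// lerD2r.
    exact: le_min2.
  - move=> i iN; exact: upper_exp_truncated_term.
have MD0 : 0 <= M `^ q * D by rewrite mulr_ge0// powR_ge0.
rewrite lee_fin.
apply: (@le_trans _ _ (expR (M `^ q * D / (n%:R `^ (eta * q))) ^+ n)).
  apply: lerXn2r; rewrite ?nnegrE ?expR_ge0 ?expR_ge1Dx//.
  by rewrite /u addr_ge0// divr_ge0 ?powR_ge0.
rewrite -expRM_natl ler_expR mulrCA ler_piMr//.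
by rewrite ler_pdivrMr ?powR_gt0// mul1r le1r_powR ?ler1n// ltW.
Qed.

(** Almost surely truncation is inactive from some index on, so the full and the
    truncated sums differ by an eventually constant amount, the witness [c]. *)
Lemma ae_weighted_sum_le P : calP P ->
  {ae P, forall w, exists c : R, \forall n \near \oo,
    \sum_(1 <= i < n.+1) a i * (X i w - mu i) <= c + n%:R `^ theta}.
Proof.
move=> calPP.
have eK i : (1 <= i)%N ->
    (P [set w | (i%:R `^ eta <= X i w)%R] <= (K / i%:R `^ (eta * q))%:E)%E.
  move=> i1; rewrite powRrM.
  apply: markov_powR => //; first exact: EXq.
  by rewrite powR_gt0// ltr0n.
have meas_le (g h : Omega -> R) : measurable_fun setT g -> measurable_fun setT h ->
    measurable [set w | g w <= h w].
  by move=> mg mh; rewrite -[X in measurable X]setTI; exact: measurable_fun_le.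
have ae1 := ae_eventually_notin P _ _ _ etaq (fun i _ =>
  meas_le (cst (i%:R `^ eta)) (X i) (measurable_cst _) (measurable_funP _)) eK.
have te : 0 < theta - eta by rewrite subr_gt0.
have [C1 [C10 expC1]] := expRN_powR_le (theta - eta) te.
have eS n : (1 <= n)%N ->
    (P [set w | (n%:R `^ theta <= truncated_sum n w)%R] <=
     (C * C1 / n%:R `^ 2)%:E)%E.
  move=> n1; apply: (@le_trans _ _ (C * expR (- n%:R `^ (theta - eta)))%:E).
    exact: truncated_sum_tail.
  by rewrite lee_fin -mulrA ler_wpM2l ?expR_ge0// expC1.
have two1 : 1 < 2 :> R by rewrite ltr1n.
have ae2 := ae_eventually_notin P _ _ _ two1 (fun n _ =>
  meas_le (cst (n%:R `^ theta)) _ (measurable_cst _)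
    (measurable_truncated_sum n)) eS.
move: ae1 ae2; apply: filterS2 => w [N1 _ XN] [N2 _ SN].
pose N := maxn 1 (maxn N1 N2).
exists (\sum_(1 <= i < N) a i * (X i w - Num.min (X i w) (i%:R `^ eta))).
exists N => // n /= Nn.
have truncE i : (N <= i)%N -> Num.min (X i w) (i%:R `^ eta) = X i w.
  move=> Ni; apply/min_idPl/ltW; rewrite ltNge; apply/negP; apply: XN => /=.
  by apply: leq_trans Ni; rewrite /N !leq_max leqnn orbT.
have -> : \sum_(1 <= i < n.+1) a i * (X i w - mu i) =
    \sum_(1 <= i < n.+1) a i * (X i w - Num.min (X i w) (i%:R `^ eta)) +
    truncated_sum n w.
  rewrite /truncated_sum -big_split/=; apply: eq_bigr => i _.
  by rewrite /truncated_term; ring.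
apply: lerD; last first.
  rewrite leNgt; apply/negP => /ltW; apply: SN => /=.
  by apply: leq_trans Nn; rewrite /N !leq_max leqnn !orbT.
rewrite (@big_cat_nat _ _ _ N)/= ?leq_max ?leqnn//; last exact: leqW.
rewrite [X in _ + X]big_nat_cond [X in _ + X]big1 ?addr0// => i.
by rewrite andbT => /andP[Ni _]; rewrite truncE// subrr mulr0.
Qed.

End one_sided_law.

(** * Upper and lower limits *)

Lemma fine_upper_exp_norm {d : measure_display} {Omega : measurableType d}
    {R : realType} (calP : set (probability Omega R)) (Y : Omega -> R) (L : R) :
  calP !=set0 -> (forall P, calP P -> (`|'E_P[Y]| <= L%:E)%E) ->
  upper_exp calP Y \is a fin_num /\ `|fine (upper_exp calP Y)| <= L.
Proof.
move=> [P calPP] YL.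
have : (upper_exp calP Y <= L%:E)%E.
  by apply: upper_exp_le => Q /YL; apply: le_trans; exact: lee_abs.
have : ((- L)%:E <= upper_exp calP Y)%E.
  apply: le_trans (expectation_le_upper_exp _ _ _ calPP).
  move: (YL P calPP); case: ('E_P[Y])%E => // y /=.
  by rewrite !lee_fin ler_norml => /andP[].
by case: (upper_exp _ _) => //= r; rewrite !lee_fin ler_norml => -> ->.
Qed.

Lemma lower_prob_eq1 {d : measure_display} {Omega : measurableType d}
    {R : realType} (calP : set (probability Omega R)) (S : set Omega) :
  calP !=set0 -> measurable S ->
  (forall P, calP P -> {ae P, forall w, S w}) -> lower_prob calP S = 1%E.
Proof.
move=> [P0 calP0] mS aeS.
have PS P : calP P -> P S = 1%E.
  move=> /aeS /negligibleP; rewrite -[in X in _ -> X](setCK S).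
  rewrite probability_setC; last exact: measurableC.
  by move=> ->; rewrite ?sube0//; exact: measurableC.
rewrite /lower_prob (_ : [set _ | _ in _] = [set 1%E]) ?ereal_inf1//.
apply/seteqP; split => [_ [P calPP <-]|_ ->] /=; first by rewrite PS.
by exists P0 => //; rewrite PS.
Qed.

(** Precomposing the test functions with [- x] reverses their common
    monotonicity, which the definition allows in both directions. *)
Lemma negatively_associatedN {d : measure_display} {Omega : measurableType d}
    {R : realType} (calP : set (probability Omega R)) (X : nat -> Omega -> R) :
  negatively_associated calP X ->
  negatively_associated calP (fun i w => - X i w).
Proof.
move=> XNA n f n1 fCb fmono.
apply: (XNA n (fun i x => f i (- x)) n1).
- move=> i /fCb[fc [B [Br fb]] f0]; split => //.
  + move=> x; apply: continuous_comp; last exact: fc.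
    exact: opp_continuous.
  + by exists B; split => // y /fb fy x _; exact: fy.
- case: fmono => h; [right|left] => i i1 x y xy; apply: h => //;
  by rewrite lerN2.
Qed.

Lemma near_ratio_le {R : realType} (S A : nat -> R) (theta c : R) :
  0 < theta -> (forall n, (1 <= n)%N -> 0 < A n) ->
  A n / n%:R `^ theta @[n --> \oo] --> +oo ->
  (\forall n \near \oo, S n <= c + n%:R `^ theta) ->
  forall e, 0 < e -> \forall n \near \oo, S n / A n <= e.
Proof.
move=> th0 A0 Agrow Sle e e0.
(* [1 <= n `^ theta], so [c + n `^ theta <= (|c| + 1) * n `^ theta]. *)
pose G := (`|c| + 1) / e.
move/cvgryPge/(_ G) : Agrow => AG.
near=> n.
have n1 : (1 <= n)%N by near: n; exists 1%N.
have n1R : 1 <= n%:R `^ theta :> R.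
  by rewrite -[leLHS](powRr0 n%:R) ler_powR ?(ltW th0)// ler1n.
rewrite ler_pdivrMr ?A0//.
have : G <= A n / n%:R `^ theta by near: n.
rewrite ler_pdivlMr ?(lt_le_trans ltr01)// /G mulrAC ler_pdivrMr//.
rewrite [A n * e]mulrC; apply: le_trans.
have : S n <= c + n%:R `^ theta by near: n.
move=> /le_trans; apply.
rewrite mulrDl mul1r lerD2r (le_trans (ler_norm c))// ler_peMr//.
Unshelve. all: by end_near. Qed.

Lemma limsup_weighted_sum {d : measure_display} {Omega : measurableType d}
    {R : realType} (calP : set (probability Omega R))
    (X : nat -> {mfun Omega >-> R}) (q K m M theta : R) (a mu A : nat -> R)
    (phi : R -> R) :
  calP !=set0 -> negatively_associated calP (fun i => X i : Omega -> R) ->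
  1 <= q -> q <= 2 ->
  (forall P i, calP P -> (1 <= i)%N ->
    ('E_P[fun w => (`|X i w| `^ q)%R] <= K%:E)%E) ->
  (forall P i, calP P -> (1 <= i)%N -> ('E_P[X i] <= (mu i)%:E)%E) ->
  (forall i, (1 <= i)%N -> `|mu i| <= m) ->
  (forall i, (1 <= i)%N -> 0 < a i) ->
  (forall i, (1 <= i)%N -> a i <= M) ->
  (forall n, (1 <= n)%N -> 0 < A n) ->
  1 < theta * q -> A n / n%:R `^ theta @[n --> \oo] --> +oo ->
  continuous phi ->
  lower_prob calP
    [set w | (limn_esup (fun n => (phi ((\sum_(1 <= i < n.+1)
                 a i * (X i w - mu i)) / A n))%:E)
              <= ereal_sup [set (phi x)%:E | x in [set x : R | (x <= 0)%R]])%E]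
    = 1%E.
Proof.
move=> calP0 XNA q1 q2 EXq EXmu mum a0 aM A0 thq Agrow phic.
apply: lower_prob_eq1 => //.
  rewrite -[X in measurable X]setTI; apply: emeasurable_fun_infty_c => //.
  apply: measurable_fun_limn_esup => n; apply/measurable_EFinP.
  apply: measurableT_comp; first exact: continuous_measurable_fun.
  apply: measurable_funM => //; apply: measurable_sum => i.
  by apply: measurable_funM => //; exact: measurable_funB.
move=> P calPP.
have th0 : 0 < theta by rewrite ltNge; apply/negP => h; nra.
(* Any [eta] strictly between [1 / q] and [theta] will do. *)
pose eta := (theta + q^-1) / 2.
have q0 : 0 < q by apply: lt_le_trans q1.
have iq : q^-1 < theta by rewrite -(ltr_pM2r q0) mulVf ?gt_eqF.
have etaq : 1 < eta * q by rewrite -ltr_pdivrMr// div1r /eta; lra.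
have etath : eta < theta by rewrite /eta; lra.
have := ae_weighted_sum_le calP X q K m M eta theta a mu calP0 XNA q1 q2 EXq
  EXmu mum a0 aM etaq etath P calPP.
apply: filterS => w [c Hc].
apply: limn_esup_comp_le => //; exact: near_ratio_le Agrow Hc.
Qed.

Theorem theorem5p1 (d : measure_display) (Omega : measurableType d)
    (R : realType) (calP : set (probability Omega R))
    (X : nat -> {mfun Omega >-> R}) (alpha beta : R) (a A : nat -> R)
    (calP0 : calP !=set0)
    (XNA : negatively_associated calP (fun i => X i : Omega -> R))
    (alpha_gt0 : 0 < alpha)
    (Xmoment : (ereal_sup
        [set upper_exp calP (fun w => (`|X i w| `^ (alpha + 1))%R)
           | i in [set i : nat | (1 <= i)%N]] < +oo)%E)
    (a_gt0 : forall i, (1 <= i)%N -> 0 < a i)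
    (a_bounded : exists M : R, forall i, (1 <= i)%N -> a i <= M)
    (A_gt0 : forall n, (1 <= n)%N -> 0 < A n)
    (beta_gt0 : 0 < beta) (beta_lt : beta < Num.min 1 alpha)
    (A_growth : A n / n%:R `^ (1 / (beta + 1)) @[n --> \oo] --> +oo)
    (phi : R -> R) (phi_cont : continuous phi) :
  lower_prob calP
    [set w | (limn_esup (fun n => (phi ((\sum_(1 <= i < n.+1)
                 a i * (X i w - fine (upper_exp calP (X i)))) / A n))%:E)
              <= ereal_sup [set (phi x)%:E | x in [set x : R | (x <= 0)%R]])%E]
    = 1%E
  /\
  lower_prob calP
    [set w | (ereal_inf [set (phi x)%:E | x in [set x : R | (0 <= x)%R]]
              <= limn_einf (fun n => (phi ((\sum_(1 <= i < n.+1)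
                 a i * (X i w - fine (lower_exp calP (X i)))) / A n))%:E))%E]
    = 1%E.
Proof.
have [M aM] := a_bounded.
pose q := Num.min 2 (alpha + 1).
have [beta1 betaalpha] : beta < 1 /\ beta < alpha.
  by move: beta_lt; rewrite lt_min => /andP[].
have q2 : q <= 2 by rewrite ge_min lexx.
have bq : beta + 1 < q by rewrite lt_min; apply/andP; split; lra.
have q1 : 1 <= q by lra.
have thq : 1 < 1 / (beta + 1) * q by rewrite mulrC mulrA mulr1 ltr_pdivlMr; lra.
(* [expR_le_moment] requires an exponent at most [2], hence the passage from
   [alpha + 1] to [q]. *)
have qle (x : R) : `|x| `^ q <= 1 + `|x| `^ (alpha + 1).
  have [x1|/ltW x1] := lerP `|x| 1.
    rewrite (@le_trans _ _ 1)// ?lerDl ?powR_ge0//.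
    have <- : 1 `^ q = 1 :> R by rewrite powR1.
    by apply: ge0_ler_powR; rewrite ?nnegrE// (le_trans _ q1).
  by rewrite ler_wpDl// ler_powR// ge_min lexx orbT.
pose s := ereal_sup [set upper_exp calP (fun w => (`|X i w| `^ (alpha + 1))%R)
           | i in [set i : nat | (1 <= i)%N]].
have EXalpha P i : calP P -> (1 <= i)%N ->
    ('E_P[fun w => (`|X i w| `^ (alpha + 1))%R] <= (fine s)%:E)%E.
  move=> calPP i1.
  have h : ('E_P[fun w => (`|X i w| `^ (alpha + 1))%R] <= s)%E.
    apply: le_trans (expectation_le_upper_exp _ _ _ calPP) _.
    by apply: ereal_sup_ubound; exists i.
  rewrite fineK// ge0_fin_numE//; apply: le_trans h.
  by apply: expectation_ge0 => w; exact: powR_ge0.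
pose K := 1 + fine s.
have EXq P i : calP P -> (1 <= i)%N ->
    ('E_P[fun w => (`|X i w| `^ q)%R] <= K%:E)%E.
  move=> calPP i1.
  apply: (@le_trans _ _ 'E_P[(cst 1 \+ (fun w => `|X i w| `^ (alpha + 1)))%R]%E).
    apply: expectation_le => //.
    - exact: measurable_norm_powR.
    - by apply: measurable_funD => //; exact: measurable_norm_powR.
    - by move=> w /=; rewrite addr_ge0 ?powR_ge0.
    - by apply: aeW => w /=; exact: qle.
  rewrite expectationD ?Lfun_cst//; last first.
    exact: Lfun1_norm_powR (EXalpha P i calPP i1).
  by rewrite expectation_cst EFinD leeD2l// EXalpha.
have EXabs P i : calP P -> (1 <= i)%N -> (`|'E_P[X i]| <= (1 + K)%:E)%E.
  by move=> calPP i1; apply: (abse_expectation_le P (X i) q K) => //; exact: EXq.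
have EXNabs P i : calP P -> (1 <= i)%N ->
    (`|'E_P[(fun w => - X i w)%R]| <= (1 + K)%:E)%E.
  move=> calPP i1; rewrite (expectationN P (X i) q K) ?abseN ?EXabs//.
  exact: EXq.
have Xfin i (i1 : (1 <= i)%N) := fine_upper_exp_norm calP (X i) (1 + K) calP0
  (fun P calPP => EXabs P i calPP i1).
have XNfin i (i1 : (1 <= i)%N) := fine_upper_exp_norm calP _ (1 + K) calP0
  (fun P calPP => EXNabs P i calPP i1).
split.
  apply: (limsup_weighted_sum calP X q K (1 + K) M (1 / (beta + 1))) => //.
  - move=> P i calPP i1.
    rewrite fineK; first exact: expectation_le_upper_exp.
    by have [] := Xfin i i1.
  - by move=> i i1; have [] := Xfin i i1.
(* The lower mean of [X i] is minus the upper mean [nu i] of [- X i]. *)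
pose Y i : {mfun Omega >-> R} := (- X i)%R.
pose nu i := fine (upper_exp calP (fun w => - X i w)).
have lowerE i : (1 <= i)%N -> fine (lower_exp calP (X i)) = - nu i.
  move=> i1; rewrite /nu -fineN; congr fine; rewrite /lower_exp /ereal_inf.
  congr (- ereal_sup _)%E; rewrite image_comp; apply: eq_imagel => P calPP /=.
  by rewrite (expectationN P (X i) q K) ?oppeK//; exact: EXq.
have := limsup_weighted_sum calP Y q K (1 + K) M (1 / (beta + 1)) a nu A
  (fun x => - phi (- x)).
move=> /(_ calP0 (negatively_associatedN _ _ XNA) q1 q2).
set S1 := [set w | _]; set S2 := [set w | _].
have -> : S1 = S2; last apply => //.
- apply/funext => w; rewrite /S1 /S2/=; congr (is_true _).
  rewrite /limn_einf leeNr /ereal_inf oppeK image_comp.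
  congr (_ <= _)%E.
    congr limn_esup; apply/funext => n /=.
    rewrite -mulNr -sumrN; congr (- phi (_ / _))%:E.
    apply: eq_big_nat => i /andP[i1 _]; rewrite lowerE// -mulrN.
    by rewrite opprD !opprK; congr (_ * (_ + _)); exact: opprK.
  congr ereal_sup; apply/seteqP; split => _ [x /= x0 <-].
    by exists (- x) => //=; rewrite oppr_ge0.
  by exists (- x) => /=; rewrite ?oppr_le0 ?opprK.
- move=> P i calPP i1; under [X in 'E_P[X]%E]eq_fun do rewrite normrN.
  exact: EXq.
- move=> P i calPP i1.
  rewrite fineK; first exact: expectation_le_upper_exp.
  by have [] := XNfin i i1.
- by move=> i i1; have [] := XNfin i i1.
- move=> x; apply: continuousN; apply: continuous_comp; last exact: phi_cont.
  exact: opp_continuous.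
Qed.
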